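(* Let $\mathcal{I}$ be either $\mathcal{N}$ or $\mathcal{M}$. Then $\mathrm{sc}(\{f\in\mathbb{R}^{\mathbb{R}}: f\text{ is }\mathcal{B}_{\mathcal{I}}\text{-measurable}\})\le[\mathrm{cof}(\mathcal{I})]^{+}$.
   Context: $\mathcal{N}$ is the $\sigma$-ideal of Lebesgue nullsets of $\mathbb{R}$ and $\mathcal{M}$ is the $\sigma$-ideal of first category (meager) subsets of $\mathbb{R}$. For $\mathcal{I}\in\{\mathcal{N},\mathcal{M}\}$, $\mathcal{B}_{\mathcal{I}}$ is the $\sigma$-algebra generated by the Borel sets and $\mathcal{I}$ (so $\mathcal{B}_{\mathcal{I}}$-measurable means Lebesgue measurable, respectively having the Baire property). $\mathrm{cof}(\mathcal{I})=\min\{|\mathcal{A}|:\mathcal{A}\subset\mathcal{I},\ \forall I\in\mathcal{I}\ \exists A\in\mathcal{A},\ I\subset A\}$, and $\kappa^+$ is the successor cardinal of $\kappa$. $\mathbb{R}^{\mathbb{R}}$ is the set of all functions $f:\mathbb{R}\to\mathbb{R}$. A difference operator is a map $D:\mathbb{R}^{\mathbb{R}}\to\mathbb{R}^{\mathbb{R}}$ of the form $(Df)(x)=\sum_{i=1}^n a_i f(x+b_i)$ with $a_i,b_i\in\mathbb{R}$; $\mathcal{D}$ is the set of difference operators. A system of difference equations is a set $S\subset\mathcal{D}\times\mathbb{R}^{\mathbb{R}}$; a function $f:\mathbb{R}\to\mathbb{R}$ is a solution to $S$ if $Df=g$ for every $(D,g)\in S$. A subsystem of $S$ is a subset of $S$.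 For $\mathcal{F}\subset\mathbb{R}^{\mathbb{R}}$ the solvability cardinal $\mathrm{sc}(\mathcal{F})$ is the minimal cardinal $\kappa$ with the following property: for every system $S$ of difference equations, if every subsystem of $S$ of cardinality less than $\kappa$ has a solution in $\mathcal{F}$, then $S$ has a solution in $\mathcal{F}$. *)

(* Defs.v *)
From HB Require Import structures.
From mathcomp Require Import all_boot all_order all_algebra.
From mathcomp Require Import all_classical all_reals all_analysis.
Set Implicit Arguments.
Unset Strict Implicit.
Unset Printing Implicit Defensive.
Import Order.TTheory GRing.Theory Num.Theory numFieldNormedType.Exports.
Local Open Scope classical_set_scope.
Local Open Scope ring_scope.
Local Open Scope card_scope.

(** * Cardinals

A cardinal is given by a type having that cardinality; two types stand for the
same cardinal when they are equipotent, and the order is [#<=]. *)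

Definition card_lt T U (A : set T) (B : set U) : Prop :=
  A #<= B /\ ~ (B #<= A).
Notation "A '#<' B" := (card_lt A B) (at level 79) : card_scope.

Definition is_min_card (P : Type -> Prop) (K : Type) : Prop :=
  P K /\ forall L : Type, P L -> [set: K] #<= [set: L].

(** The default value [void] is never used for a satisfiable [P], see
[min_cardP]. *)
Definition min_card (P : Type -> Prop) : Type :=
  if pselect (exists K, is_min_card P K) is left h then sval (cid h) else void.

Lemma card_le_inj T U (f : T -> U) : injective f -> [set: T] #<= [set: U].
Proof.
move=> fi; have fe : f @` [set: T] #= [set: T].
  by apply: inj_card_eq => x y _ _; exact: fi.
by rewrite -(card_le_eql fe); exact: card_leT.
Qed.

(** A maximal family of choice functions that are pairwise different in every
coordinate exhausts one of the coordinates. *)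
Lemma family_min_card (I : Type) (X : I -> Type) (i0 : I) :
  exists i, forall j, [set: X i] #<= [set: X j].
Proof.
pose ok (G : set (forall i, X i)) :=
  forall f g, G f -> G g -> forall i, f i = g i -> f = g.
have [|G [Gok Gmax]] := @Zorn_bigcup _ ok.
  move=> F Fok Ftot f g [A FA Af] [B FB Bg] i fg.
  case: (Ftot _ _ FA FB) => [AB|BA].
    by apply: (Fok _ FB _ _ _ _ i) => //; exact: AB.
  by apply: (Fok _ FA _ _ _ _ i) => //; exact: BA.
have [[i isurj]|nosurj] :=
    pselect (exists i, forall y, exists2 f, G f & f i = y).
  exists i => j.
  have /choice[h hP] : forall y, exists f, G f /\ f i = y.
    by move=> y; have [f] := isurj y; exists f.
  apply: (@card_le_inj _ _ (fun y => h y j)) => y z yz.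
  have [Gy <-] := hP y; have [Gz <-] := hP z.
  by rewrite (Gok _ _ Gy Gz j yz).
have avoid i : {y : X i | forall f, G f -> f i <> y}.
  apply: cid; apply: contrapT => /forallNP nex; apply: nosurj.
  exists i => y; apply: contrapT => nf; apply: (nex y) => f Gf fy.
  by apply: nf; exists f.
pose f0 i : X i := sval (avoid i).
have f0P f i : G f -> f i <> f0 i by exact: (svalP (avoid i)).
exfalso; apply: (Gmax (G `|` [set f0])).
  split; first by move=> f Gf; left.
  by move=> /(_ f0 (or_intror erefl))/(f0P _ i0); apply.
move=> f g [Gf|->] [Gg|->] i // fg; first exact: Gok fg.
  by case: (f0P _ i Gf fg).
by case: (f0P _ i Gg (esym fg)).
Qed.

Lemma card_le_total (T U : Type) :
  [set: T] #<= [set: U] \/ [set: U] #<= [set: T].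
Proof.
have [[] le] := @family_min_card bool (fun b => if b then T else U) true.
  by left; exact: (le false).
by right; exact: (le true).
Qed.

Lemma min_cardP (P : Type -> Prop) :
  (exists K, P K) -> is_min_card P (min_card P).
Proof.
move=> [K PK]; rewrite /min_card; case: pselect => [h|].
  exact: (svalP (cid h)).
case; pose Q (A : set K) := exists L : Type, P L /\ [set: L] #= A.
have QK : Q [set: K] by exists K.
have [[A [L [PL LA]]] Amin] :=
  @family_min_card {A | Q A} (fun A => set_type (sval A)) (exist _ _ QK).
have QL B : Q B -> [set: L] #<= B.
  move=> QB; rewrite (card_le_eql LA) -(card_le_eql (card_setT A)).
  by rewrite -(card_le_eqr (card_setT B)); exact: (Amin (exist _ _ QB)).
exists L; split=> // M PM; have [MK|KM] := card_le_total M K.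
  have /card_leP[f] := MK.
  have fi : {in [set: [set: M]] &, injective f}.
    by move=> x y xM yM; exact: inj.
  pose B := [set val (f (SigSub (mem_setT x))) | x in [set: M]].
  have MB : [set: M] #= B.
    apply/card_esym/inj_card_eq => x y _ _ /val_inj.
    by move=> /fi -/(_ (mem_setT _) (mem_setT _)) /(congr1 val).
  by rewrite (card_le_eqr MB); apply: QL; exists M.
exact: card_le_trans (QL _ QK) KM.
Qed.

Lemma Cantor T : [set: T] #< [set: set T].
Proof.
split; first by apply: (@card_le_inj _ _ set1) => x y /seteqP[/(_ x erefl)].
move=> /card_leP[f].
have fi : injective f.
  by move=> A B; apply: inj; rewrite inE.
pose g (A : set T) : T := val (f (SigSub (mem_setT A))).
have gi : injective g by move=> A B /val_inj/fi/(congr1 val).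
pose D : set T := [set x | exists2 A, g A = x & ~ A x].
have DN : ~ D (g D) by move=> /[dup] DgD [A /gi -> /(_ DgD)].
by apply: (DN); exists D.
Qed.

Definition succ_card (K : Type) : Type :=
  min_card (fun L => [set: K] #< [set: L]).

Lemma succ_cardP (K : Type) :
  is_min_card (fun L => [set: K] #< [set: L]) (succ_card K).
Proof. by apply: min_cardP; exists (set K); exact: Cantor. Qed.

(** * The ideals and their cofinality *)

Section ideals.
Context {R : realType}.

Definition null_ideal : set (set R) :=
  [set A | (@lebesgue_measure R).-negligible A].

Definition nowhere_dense (A : set R) : Prop := (closure A)° = set0.

Definition meager_ideal : set (set R) :=
  [set A | exists F : nat -> set R,
     (forall n, nowhere_dense (F n)) /\ A = \bigcup_n F n].

Definition cofinal_family (I A : set (set R)) : Prop :=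
  A `<=` I /\ forall X, I X -> exists Y, A Y /\ X `<=` Y.

Definition cof (I : set (set R)) : Type :=
  min_card (fun K => exists A, cofinal_family I A /\ [set: K] #= A).

Lemma cofP (I : set (set R)) :
  is_min_card (fun K => exists A, cofinal_family I A /\ [set: K] #= A) (cof I).
Proof.
apply: min_cardP; exists I, I; split; last by rewrite card_setT.
by split=> // X IX; exists X; split.
Qed.

(** [measurable : set (set R)] is the Borel sigma-algebra, cf.
[RGenOpens.measurableE]; [g_sigma_algebraType G] carries the sigma-algebra
generated by [G]. *)
Definition BI_generators (I : set (set R)) : set (set R) :=
  (measurable : set (set R)) `|` I.

Definition BI_measurable (I : set (set R)) : set (R -> R) :=
  [set f | measurable_fun [set: g_sigma_algebraType (BI_generators I)]
             (f : g_sigma_algebraType (BI_generators I) -> R)].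

End ideals.

Section difference_equations.
Context {R : realType}.

Definition difference_operator : set ((R -> R) -> (R -> R)) :=
  [set D | exists (n : nat) (a b : 'I_n -> R),
     forall f x, D f x = \sum_(i < n) a i * f (x + b i)].

Definition is_system (S : set (((R -> R) -> (R -> R)) * (R -> R))) : Prop :=
  S `<=` difference_operator `*` setT.

Definition is_solution (S : set (((R -> R) -> (R -> R)) * (R -> R)))
    (f : R -> R) : Prop :=
  forall D g, S (D, g) -> D f = g.

Definition solvable_in (F : set (R -> R))
    (S : set (((R -> R) -> (R -> R)) * (R -> R))) : Prop :=
  exists2 f, F f & is_solution S f.

Definition sc_property (F : set (R -> R)) (K : Type) : Prop :=
  forall S, is_system S ->
    (forall T, T `<=` S -> T #< [set: K] -> solvable_in F T) ->
    solvable_in F S.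

Definition sc (F : set (R -> R)) : Type := min_card (sc_property F).

Lemma scP (F : set (R -> R)) : is_min_card (sc_property F) (sc F).
Proof.
apply: min_cardP; exists (set (((R -> R) -> (R -> R)) * (R -> R))) => S _.
apply=> //; have [le nle] := Cantor (((R -> R) -> (R -> R)) * (R -> R)).
split; first exact: card_le_trans (card_leT S) le.
by move=> leS; apply: nle; exact: card_le_trans leS (card_leT S).
Qed.

End difference_equations.

(* Main.v *)
From HB Require Import structures.
Require Import Defs.
From mathcomp Require Import all_boot all_order all_algebra.
From mathcomp Require Import all_classical all_reals all_analysis.
From mathcomp Require Import measurable_realfun ring lra.
Import Order.TTheory GRing.Theory Num.Theory numFieldNormedType.Exports.
Local Open Scope classical_set_scope.
Local Open Scope card_scope.

(** The proof splits a solution into a part that is determined modulo the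
ideal [I] and a part that vanishes outside a set of [I].

The splitting comes from an operator [T] on all functions (lemma [lifting])
that is linear enough to commute with every difference operator, depends on
its argument only modulo [I], and changes a measurable function only on a set
of [I].  It is [T f x = L (fun u => f (x + u))], where [L] is any linear
functional on all functions that extends the limit at [0] along the filter of
sets of density one at [0]; in the category case this filter consists of the
sets that are residual in a neighbourhood of [0].  Commutation with difference
operators is automatic, since these commute with translations, and [T f = f]
modulo [I] is the Lebesgue density theorem (respectively, the fact that a set
with the Baire property is open up to a meager set).

If [f] is a measurable solution of [D f = g], then [D (T f) = T g], and
[f - T f] solves [D h = g - T g] and vanishes outside a set of [I].  So it
suffices to solve separately:
- all the equations [D f = g] modulo [I].  Whenever a measurable function fails
  an equation modulo [I], it lies in one of countably many sets of functions
  none of whose members solves the equation ([separating_code]), so some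
  countable subsystem already forces the whole system modulo [I]
  ([countable_subsystem]);
- all the equations [D h = g - T g] by one [h] that vanishes outside a set of
  [I].  For a fixed set [B], a system of linear equations with finitely many
  unknowns each has a solution supported in [B] as soon as its finite
  subsystems do ([linear_compactness]).  If this failed for every [B] in a
  cofinal family, one finite obstruction per [B] would give a subsystem of at
  most [cof I] equations without a measurable solution.
The sum of [T f] and [h] is the solution wanted ([sc_property_succ_cof]).

Measure and category enter only through the interface [smallness], which has
the instances [null_smallness] and [meager_smallness]. *)

Section cardinals.
Set Implicit Arguments.
Unset Strict Implicit.

(** * Cardinal arithmetic *)

Lemma card_leTP T U (B : set U) :
  [set: T] #<= B -> exists2 f : T -> U, injective f & forall x, B (f x).
Proof.
move=> /card_leP[f]; exists (fun x => val (f (SigSub (in_setT x)))).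
  move=> x y /val_inj fxy.
  by have /(congr1 val) : SigSub (in_setT x) = SigSub (in_setT y) :> [set: T] by
    apply: inj fxy; rewrite inE.
by move=> x; exact: set_valP.
Qed.

Lemma card_le_in_inj T U (A : set T) (f : T -> U) :
  {in A &, injective f} -> A #<= [set: U].
Proof.
move=> fi; have fe : f @` A #= A by exact: inj_card_eq.
by rewrite -(card_le_eql fe); exact: card_leT.
Qed.

(** A maximal family of pairwise disjoint injective sequences in [K] leaves out
only finitely many points, so that [K] is essentially a product with [nat],
and such a product absorbs one more factor [nat]. *)
Lemma card_mul_nat (K : Type) : [set: nat] #<= [set: K] ->
  exists h : K * nat -> K, injective h.
Proof.
move=> infK.
pose ok (G : set (nat -> K)) :=
  (forall f, G f -> injective f) /\
  forall f g, G f -> G g -> forall i j, f i = g j -> f = g.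
have [|G [[Gi Gd] Gmax]] := @Zorn_bigcup _ ok.
  move=> F Fok Ftot; split=> [f [A FA Af]|f g [A FA Af] [B FB Bg] i j fg].
    by have [+ _] := Fok _ FA; exact.
  case: (Ftot _ _ FA FB) => [AB|BA].
    by have [_ H] := Fok _ FB; apply: (H _ _ _ _ i j) => //; exact: AB.
  by have [_ H] := Fok _ FA; apply: (H _ _ _ _ i j) => //; exact: BA.
pose U := [set k | exists2 f, G f & exists i, f i = k].
have finU : finite_set (~` U).
  apply: contrapT => /infiniteP/card_leTP[f fi fU].
  apply: (Gmax (G `|` [set f])).
    split; first by move=> g Gg; left.
    move=> /(_ f (or_intror erefl)) Gf.
    by apply: (fU 0%N); exists f => //; exists 0%N.
  split=> [g [/Gi//|->//]|g g' [Gg|->] [Gg'|->] i j //]; first exact: Gd.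
    by move=> e; case: (fU j); exists g => //; exists i.
  by move=> e; case: (fU i); exists g' => //; exists j.
have [g0 Gg0] : G !=set0.
  apply: contrapT => /set0P/negP/negPn/eqP G0.
  have : finite_set [set: K].
    suff <- : ~` U = [set: K] by [].
    by apply/seteqP; split=> // k _ [f]; rewrite G0.
  exact/infiniteP.
have /countable_injP[r ri] := finite_set_countable finU.
(* The points on a sequence get even codes; the left-over points get odd codes
   along the fixed sequence [g0]. *)
have /choice[c cP] : forall k, exists c : (nat -> K) * nat, G c.1 /\
    ((exists2 i, c.1 i = k & c.2 = i.*2) \/
     (~ U k /\ c = (g0, (r k).*2.+1))).
  move=> k; have [[f Gf [i fik]]|nUk] := pselect (U k).
    by exists (f, i.*2); split=> //; left; exists i.
  by exists (g0, (r k).*2.+1); split=> //; right.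
have ci k l : c k = c l -> k = l.
  move=> e; case: (cP k) (cP l); rewrite -e.
  move=> Gk [[i ki i2]|[nUk ck]] [_ [[j lj j2]|[nUl cl]]].
  - rewrite -ki -lj; move: j2; rewrite i2 => /(congr1 half).
    by rewrite !doubleK => ->.
  - by move: i2; rewrite cl/= => /(congr1 odd); rewrite /= !odd_double.
  - by move: j2; rewrite ck/= => /(congr1 odd); rewrite /= !odd_double.
  - move: cl; rewrite ck => -[] /(congr1 half); rewrite !doubleK.
    by apply: ri; rewrite inE.
exists (fun p => (c p.1).1 (pickle ((c p.1).2, p.2))).
move=> [k m] [l n] /= e.
have [Gk _] := cP k; have [Gl _] := cP l.
have fe := Gd _ _ Gk Gl _ _ e.
move: e; rewrite -fe => /(Gi _ Gk) /(pcan_inj pickleK) [e2 ->].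
congr (_, _); apply: ci; move: fe e2.
by case: (c k) (c l) => [? ?] [? ?] /= -> ->.
Qed.

Lemma card_bigcup_countable (K E : Type) (F : K -> set E) :
  [set: nat] #<= [set: K] -> (forall a, countable (F a)) ->
  \bigcup_a F a #<= [set: K].
Proof.
move=> /card_mul_nat[h hi] Fc.
have /choice[j jP] a : exists j : E -> nat, {in F a &, injective j}.
  exact/countable_injP.
have [->|/set0P[e0 [a0 _ _]]] := eqVneq (\bigcup_a F a) set0.
  exact: card_ge0.
have /choice[a aP] e : exists a, (\bigcup_a F a) e -> F a e.
  have [[a _ Fae]|no] := pselect ((\bigcup_a F a) e); first by exists a.
  by exists a0.
apply: (@card_le_in_inj _ _ _ (fun e => h (a e, j (a e) e))) => x y.
rewrite !inE => /aP Fx /aP + /hi [axy]; rewrite -axy => Fy /jP.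
by apply; rewrite inE.
Qed.

Lemma card_le_lt_succ (E K : Type) (T : set E) :
  T #<= [set: K] -> T #< [set: succ_card K].
Proof.
move=> TK; have [[le nle] _] := succ_cardP K; split.
  exact: card_le_trans TK le.
by move=> leT; apply: nle; exact: card_le_trans leT TK.
Qed.

End cardinals.

(** * Linear extension and compactness of linear systems *)

Section linear_extension.
Set Implicit Arguments.
Unset Strict Implicit.
Local Open Scope ring_scope.

Let graph_like {K : fieldType} {V : lmodType K} (G : set (V * K)) :=
  [/\ G (0, 0),
      forall a u v, G u -> G v -> G (a *: u.1 + v.1, a * u.2 + v.2) &
      forall c, G (0, c) -> c = 0].

(** The data form a linear graph in [V * K]; a maximal linear graph that is
still single-valued is total, because a vector [v] outside its domain could be
given the value [0].  Describing the data by its graph avoids having to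
introduce the subspace on which it is defined. *)
Lemma linear_extension (K : fieldType) (V : lmodType K) (G : set (V * K)) :
  G (0, 0) ->
  (forall a u v, G u -> G v -> G (a *: u.1 + v.1, a * u.2 + v.2)) ->
  (forall c, G (0, c) -> c = 0) ->
  exists L : {linear V -> K^o}, forall v c, G (v, c) -> L v = c.
Proof.
move=> G0 Glin Gfun; have Gok : graph_like G by split.
have [|B [[H0 Hlin Hfun] Bmax]] :=
    @Zorn_bigcup _ (fun B => graph_like (G `|` B)).
  move=> F Fok Ftot.
  have chain u v : (G `|` \bigcup_(X in F) X) u ->
      (G `|` \bigcup_(X in F) X) v ->
      exists H, [/\ graph_like H, H `<=` G `|` \bigcup_(X in F) X, H u & H v].
    have FX X : F X -> G `|` X `<=` G `|` \bigcup_(X in F) X.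
      by move=> FX; apply: setUS; exact: bigcup_sup.
    move=> [Gu|[A FA Au]] [Gv|[A' FA' Av]].
    - by exists G; split=> //; left.
    - by exists (G `|` A'); split; [exact: Fok|exact: FX|left|right].
    - by exists (G `|` A); split; [exact: Fok|exact: FX|right|left].
    - case: (Ftot _ _ FA FA') => [s|s].
        exists (G `|` A'); split; [exact: Fok|exact: FX| |by right].
        by right; exact: s.
      exists (G `|` A); split; [exact: Fok|exact: FX|by right| ].
      by right; exact: s.
  split; first by left.
    move=> a u v Hu Hv; have [H [[_ Hlin _] sH {}Hu {}Hv]] := chain _ _ Hu Hv.
    by apply: sH; exact: Hlin.
  move=> c Hc; have [H [[_ _ Hfun] _ {}Hc _]] := chain _ _ Hc Hc.
  exact: Hfun.
have HN u : (G `|` B) u -> (G `|` B) (- u.1, - u.2).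
  move=> Hu; have := Hlin (-1) _ _ Hu H0; rewrite /= !addr0.
  by rewrite scaleN1r mulN1r.
have Huniq v c c' : (G `|` B) (v, c) -> (G `|` B) (v, c') -> c = c'.
  move=> vc vc'; apply/eqP; rewrite -subr_eq0; apply/eqP; apply: Hfun.
  have := Hlin (-1) _ _ vc' vc; rewrite /= scaleN1r mulN1r addNr.
  by rewrite addrC.
have dom v : exists c, (G `|` B) (v, c).
  apply: contrapT => nv.
  (* the graph extended by [v |-> 0] *)
  pose H' := [set w | exists t : K, (G `|` B) (w.1 - t *: v, w.2)].
  have sH : G `|` B `<=` H'.
    by move=> w Hw; exists 0; rewrite scale0r subr0 -surjective_pairing.
  have H'v : H' (v, 0) by exists 1; rewrite /= scale1r subrr.
  apply: (Bmax H').
    split; first by move=> w Bw; apply: sH; right.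
    by move=> /(_ _ H'v) Bv; apply: nv; exists 0; right.
  rewrite (_ : G `|` H' = H'); last first.
    by apply: setUidr; move=> w Gw; apply: sH; left.
  split; first exact: sH.
    move=> a u w [t Hu] [s Hw]; exists (a * t + s).
    have := Hlin a _ _ Hu Hw; rewrite /=; congr ((G `|` B) (_, _)).
    by rewrite scalerBr scalerDl scalerA opprD addrACA.
  move=> c [t] /=; have [->|t0] := eqVneq t 0.
    by rewrite scale0r subr0 => /Hfun.
  move=> Ht; case: nv; exists (- (t^-1 * c)).
  have := HN _ (Hlin t^-1 _ _ Ht H0).
  by rewrite /= sub0r scalerN scalerA mulVf// scale1r !addr0 opprK.
have /choice[L LP] := dom.
have Llin : linear (L : V -> K^o).
  by move=> a u v; apply: Huniq (LP _) _; exact: (Hlin a _ _ (LP u) (LP v)).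
pose linL := GRing.isLinear.Build K V K^o _ (L : V -> K^o) Llin.
exists (HB.pack_for {linear V -> K^o} (L : V -> K^o) linL) => v c Gv.
by apply: Huniq (LP _) _; left.
Qed.

End linear_extension.

Section linear_compactness.
Set Implicit Arguments.
Unset Strict Implicit.
Local Open Scope ring_scope.

(** The solution is read off from a linear functional on the space of all
functionals of [h], evaluated at the functionals [h |-> h x].  The functional
has to send [psi] to [d] whenever finitely many of the equations imply
[psi h = d]; these prescriptions are closed under linear combinations, and they
are consistent because finitely many equations have a common solution. *)
Lemma linear_compactness (K : fieldType) (X E : Type) (S : set E)
    (phi : E -> (X -> K) -> K) (c : E -> K) (A : set X) :
  (forall e, S e -> exists (n : nat) (a : 'I_n -> K) (x : 'I_n -> X),
    forall h, phi e h = \sum_(i < n) a i * h (x i)) ->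
  (forall F, finite_set F -> F `<=` S -> exists h,
    (forall x, ~ A x -> h x = 0) /\ forall e, F e -> phi e h = c e) ->
  exists h, (forall x, ~ A x -> h x = 0) /\ forall e, S e -> phi e h = c e.
Proof.
move=> phiE Fsol.
pose sol F h := (forall x, ~ A x -> h x = 0) /\
  forall e : E, F e -> phi e h = c e.
pose G := [set w : ((X -> K) -> K^o) * K | exists F,
  [/\ finite_set F, F `<=` S & forall h, sol F h -> w.1 h = w.2]].
have [|||L LG] := @linear_extension K ((X -> K) -> K^o) G.
- by exists set0; split.
- move=> a u v [F [finF FS uF]] [F' [finF' FS' vF']].
  exists (F `|` F'); split; first by rewrite finite_setU.
    by move=> e [/FS|/FS'].
  move=> h [hA hF]; change (a * u.1 h + v.1 h = a * u.2 + v.2).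
  congr (a * _ + _).
    by apply: uF; split=> // e Fe; apply: hF; left.
  by apply: vF'; split=> // e F'e; apply: hF; right.
- move=> d [F [finF FS dF]]; have [h hF] := Fsol _ finF FS.
  by have /= <- := dF h hF.
exists (fun x => L (fun h => h x)); split=> [x nAx|e Se].
  apply: LG; exists set0; split=> //.
  by move=> h [+ _] /=; apply.
have [n [a [x phix]]] := phiE _ Se; rewrite phix.
have <- : L (phi e) = c e.
  apply: LG; exists [set e]; split=> [//|_ ->//|h [_]]; exact.
rewrite (_ : phi e = \sum_(i < n) a i *: (fun h : X -> K => (h (x i) : K^o))).
  by rewrite linear_sum; apply: eq_bigr => i _; rewrite linearZ.
by apply/funext => h; rewrite phix fct_sumE.
Qed.

End linear_compactness.

(** * Ideals with a density theorem *)

Section smallness.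
Set Implicit Arguments.
Unset Strict Implicit.
Local Open Scope ring_scope.
Context {R : realType}.

(** What the argument needs to know about an ideal: it is a translation
invariant sigma-ideal, and [small e A], a notion of [A] having size at most
[e], for which a whole ball is not small and the density theorem holds.  For
null sets [small e] bounds the outer measure by [e]; for meager sets it means
meager, whatever [e] is.  Keeping [e] in the second case lets both share one
scale-dependent form of the density theorem. *)
Record smallness (I : set (set R)) := Smallness {
  small : R -> set R -> Prop;
  ideal_sub : forall A B, B `<=` A -> I A -> I B;
  ideal_bigcup : forall F : (set R)^nat,
    (forall n, I (F n)) -> I (\bigcup_n F n);
  ideal_shift : forall A c, I A -> I [set x | A (c + x)];
  ideal_set1 : forall x, I [set x];
  small0 : small 0 set0;
  smallS : forall A B e e', B `<=` A -> e <= e' -> small e A -> small e' B;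
  smallU : forall A B e e',
    small e A -> small e' B -> small (e + e') (A `|` B);
  small_shift : forall A c e, small e A -> small e [set x | A (c + x)];
  small_ideal : forall A e, I A -> 0 < e -> small e A;
  small_ball : forall r, 0 < r -> ~ small r (ball 0 r);
  small_density : forall B : set R, <<s BI_generators I >> B ->
    I [set y | B y /\ ~ forall e, 0 < e ->
      \forall r \near 0^'+, small (e * r) (ball 0 r `\` [set u | B (y + u)])]
}.

End smallness.

Section density_filter.
Set Implicit Arguments.
Unset Strict Implicit.
Local Open Scope ring_scope.
Context {R : realType} {I : set (set R)} (sm : smallness I).

(** The sets whose complement has density [0] at the origin. *)
Definition density_filter : set_system R := [set G | forall e, 0 < e ->
  \forall r \near 0^'+, small sm (e * r) (ball 0 r `\` G)].

Lemma small_bigU n (e : 'I_n -> R) (Z : 'I_n -> set R) :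
  (forall i, small sm (e i) (Z i)) ->
  small sm (\sum_(i < n) e i) (\big[setU/set0]_(i < n) Z i).
Proof.
move=> sZ; apply: (big_ind2 (fun e Z => small sm e Z)) => //.
  exact: small0.
by move=> x1 x2 y1 y2; exact: smallU.
Qed.

Lemma ideal_bigcup_countable (T : Type) (D : set T) (F : T -> set R) :
  countable D -> (forall t, D t -> I (F t)) -> I (\bigcup_(t in D) F t).
Proof.
move=> /countable_injP[f fi] IF.
pose F' n := \bigcup_(t in D `&` [set t | f t = n]) F t.
have : I (\bigcup_n F' n).
  apply: (ideal_bigcup sm) => n.
  have [[t [Dt ftn]]|no] := pselect (exists t, D t /\ f t = n).
    apply: (ideal_sub sm) (IF t Dt) => x [t' [Dt' ft'n]].
    by rewrite (fi t' t) ?inE//= ft'n ftn.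
  apply: (ideal_sub sm) (ideal_set1 sm 0) => x [t [Dt ftn] _].
  by case: no; exists t.
by apply: (ideal_sub sm) => x [t Dt Ftx]; exists (f t) => //; exists t.
Qed.

Lemma idealU A B : I A -> I B -> I (A `|` B).
Proof.
move=> IA IB; have : I (\bigcup_(b in [set: bool]) if b then A else B).
  by apply: ideal_bigcup_countable => [|[]]//; exact: countableP.
by apply: (ideal_sub sm) => x [Ax|Bx]; [exists true|exists false].
Qed.

Lemma idealN : ~ I [set: R].
Proof.
move=> IT; have := @small_ball _ _ sm _ (@ltr01 R); apply.
by apply: small_ideal => //; exact: (ideal_sub sm _ IT).
Qed.

#[local] Instance density_filter_proper : ProperFilter density_filter.
Proof.
apply: Build_ProperFilter_ex => [G FG|].
  apply: contrapT => noG.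
  have : \forall r \near 0^'+, small sm (1 * r) (ball 0 r `\` G).
    exact: FG ltr01.
  have r0 : \forall r \near (0 : R)^'+, 0 < r by exact: nbhs_right_gt.
  move=> /(filterI r0) /filter_ex[r [/= {}r0]]; rewrite mul1r.
  rewrite (_ : _ `\` G = ball 0 r); first exact: small_ball.
  apply/seteqP; split=> x; first by case.
  by move=> ?; split=> // Gx; case: noG; exists x.
split=> [e e0|P Q FP FQ e e0|P Q PQ FP e e0].
- near=> r; rewrite setDT; apply: (@smallS _ _ sm set0 _ 0) (small0 _) => //.
  by rewrite mulr_ge0// ltW.
- have e20 : 0 < e / 2 by rewrite divr_gt0.
  near=> r; rewrite setDIr (splitr e) mulrDl.
  by apply: smallU; near: r; [exact: FP|exact: FQ].
- near=> r; have : small sm (e * r) (ball 0 r `\` P) by near: r; exact: FP.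
  by apply: smallS => // x [? nQ]; split=> // /PQ.
Unshelve. all: by end_near. Qed.

Lemma density_filter_ideal A : I A -> density_filter (~` A).
Proof.
move=> IA e e0; near=> r; rewrite setDE setCK.
apply: small_ideal; last by rewrite mulr_gt0.
by apply: (ideal_sub sm) IA => x [].
Unshelve. all: by end_near. Qed.

(** Almost every point is a density point of every set [f @^-1` J] containing
it, for [J] in the countably many rational balls; this is approximate
continuity of [f] at that point. *)
Lemma BI_measurable_density_cvg f : BI_measurable I f ->
  I [set x | ~ f (x + u) @[u --> density_filter] --> f x].
Proof.
move=> mf.
pose B (p : rat * rat) := f @^-1` ball (ratr p.1 : R) (ratr p.2).
have IB p : I [set y | B p y /\ ~ density_filter [set u | B p (y + u)]].
  apply: small_density; rewrite -(setTI (B p)).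
  by apply: mf => //; rewrite ball_itv.
have := ideal_bigcup_countable (countableP [set: rat * rat]) (fun p _ => IB p).
apply: (ideal_sub sm) => y; apply: contra_notP => ny.
apply/cvgrPdist_lt => e e0.
have [q] := @rat_in_itvoo R 0 (e / 2) ltac:(by rewrite divr_gt0).
rewrite in_itv/= => /andP[q0 qe].
have [p] := @rat_in_itvoo R (f y - ratr q) (f y + ratr q) ltac:(lra).
rewrite in_itv/= => /andP[p1 p2].
have Bpq : density_filter [set u | B (p, q) (y + u)].
  apply: contrapT => nd; apply: ny; exists (p, q) => //; split=> //.
  by rewrite /B /= /ball/= ltr_norml; apply/andP; split; lra.
near=> u; have : B (p, q) (y + u) by near: u; exact: Bpq.
rewrite /B /= /ball/= !ltr_norml => /andP[? ?].
by apply/andP; split; lra.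
Unshelve. all: by end_near. Qed.

Lemma BI_measurable_ae f f0 : BI_measurable I f0 -> I [set x | f x <> f0 x] ->
  BI_measurable I f.
Proof.
move=> mf0 ff0 _ Y mY; set Z := [set x | f x <> f0 x] in ff0.
have ZI A : I A -> measurable (A : set (g_sigma_algebraType (BI_generators I))).
  by move=> IA; apply: sub_sigma_algebra; right.
rewrite setTI (_ : f @^-1` Y = (f0 @^-1` Y `\` Z) `|` (f @^-1` Y `&` Z)).
  apply: measurableU.
    apply: measurableD; last exact: ZI.
    by rewrite -[_ @^-1` _]setTI; exact: mf0.
  by apply: ZI; apply: (ideal_sub sm) ff0 => x [].
apply/seteqP; split=> x /=.
  move=> Yx; have [Zx|nZ] := pselect (Z x); first by right.
  by left; split=> //; rewrite -(contrapT nZ).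
by case=> [[+ /contrapT ->]|[]].
Qed.

(** [T f x] applies one fixed linear functional to the translate of [f] by [x],
so that [T] commutes with difference operators; the functional extends the limit
along the density filter, so that [T f x = f x] wherever [f] is approximately
continuous. *)
Lemma lifting : exists T : (R -> R) -> (R -> R),
  [/\ forall D f, difference_operator D -> D (T f) = T (D f),
      forall f g, I [set x | f x <> g x] -> T f = T g &
      forall f, BI_measurable I f -> I [set x | T f x <> f x]].
Proof.
pose G := [set w : (R -> R^o) * R | w.1 @ density_filter --> w.2].
have [|||L LG] := @linear_extension R (R -> R^o) G.
- exact: cvg_cst.
- move=> a u v cu cv; apply: cvgD => //.
  by apply: cvgM => //; exact: cvg_cst.
- by move=> c; move=> /(cvg_unique (@norm_hausdorff _ _))/(_ (cvg_cst 0)).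
pose T (f : R -> R) x := L (fun u => f (x + u)).
have TE f f' : I [set x | f x <> f' x] -> forall x, T f x = T f' x.
  move=> If x; apply/eqP; rewrite -subr_eq0 -linearB; apply/eqP; apply: LG.
  apply: (@cvg_trans _ (cst 0 @ density_filter)); last exact: cvg_cst.
  apply: near_eq_cvg.
  near=> u; have e : f (x + u) = f' (x + u).
    apply: contrapT; near: u.
    exact: (density_filter_ideal (ideal_shift sm x If)).
  by rewrite /= -[RHS]/(f (x + u) - f' (x + u)) e subrr.
exists T; split=> [D f [n [a [b DE]]]|f g fg|f mf].
- apply/funext => x; rewrite DE /T.
  rewrite (_ : (fun u => D f (x + u)) =
      \sum_(i < n) a i *: (fun u : R => (f (x + b i + u) : R^o))).
    by rewrite linear_sum; apply: eq_bigr => i _; rewrite linearZ.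
  apply/funext => u; rewrite DE fct_sumE; apply: eq_bigr => i _.
  by rewrite addrAC.
- by apply/funext => x; exact: TE.
- apply: (ideal_sub sm) (BI_measurable_density_cvg mf) => x.
  by apply: contra_not => cf; exact: (LG _ (f x)).
Unshelve. all: by end_near. Qed.

End density_filter.

(** * Countably many equations decide the system modulo the ideal *)

Section countable_subsystem.
Set Implicit Arguments.
Unset Strict Implicit.
Local Open Scope ring_scope.
Context {R : realType} {I : set (set R)} (sm : smallness I).
#[local] Existing Instance density_filter_proper.

(** A code is a finite list of conditions, each saying that on a rational ball
[f] is close to a rational value up to a small set.  The sets of functions
satisfying a code form a countable network, which plays the role of a countable
base of the topology of convergence in measure. *)
Definition code : Type := seq (rat * rat * rat * rat * rat).

Definition rball (p s : rat) : set R := ball (ratr p : R) (ratr s).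

Definition satisfies (k : code) (f : R -> R) := forall p s t q e : rat,
  (p, s, t, q, e) \in k ->
  small sm (ratr t) (rball p s `\` f @^-1` rball q e).

Lemma BI_measurable_generic_cvg f n (b : 'I_n -> R) : BI_measurable I f ->
  I [set x | ~ forall i,
    f (x + b i + u) @[u --> density_filter sm] --> f (x + b i)].
Proof.
move=> mf; have := ideal_bigcup_countable sm (countableP [set: 'I_n])
  (fun i _ => ideal_shift sm (b i) (BI_measurable_density_cvg sm mf)).
apply: (ideal_sub sm) => x /existsNP[i ni]; exists i => //=.
by rewrite addrC.
Qed.

(** At a point [x] where [D f x <> g x] and where [f] is approximately
continuous at all the points [x + b i], finitely many rational data on [f]
exclude [D f' = g] for every [f'] sharing them.  The function [f0] serves to
make [g] approximately continuous at [x].  The radius [r] is so small that the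
sets where the functions involved are far from their values at [x] have total
size at most [r] inside the ball of radius [r]; hence they do not cover it, and
at a point not covered both sides of the equation are still apart. *)
Lemma separating_code D g f0 f : difference_operator D ->
  BI_measurable I f0 -> D f0 = g -> BI_measurable I f ->
  ~ I [set x | D f x <> g x] ->
  exists k, satisfies k f /\ forall f', satisfies k f' -> D f' <> g.
Proof.
move=> [n [a [b DE]]] mf0 Df0 mf nI.
have [x [Dgx cf cf0]] : exists x, [/\ D f x <> g x,
    forall i, f (x + b i + u) @[u --> density_filter sm] --> f (x + b i) &
    forall i, f0 (x + b i + u) @[u --> density_filter sm] --> f0 (x + b i)].
  apply: contrapT => nx; apply: nI.
  have := idealU sm (BI_measurable_generic_cvg b mf)
                    (BI_measurable_generic_cvg b mf0).
  apply: (ideal_sub sm) => x Dgx.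
  apply: contrapT => /not_orP[/contrapT ? /contrapT ?].
  by apply: nx; exists x; split.
have cg : g (x + u) @[u --> density_filter sm] --> g x.
  rewrite -Df0 DE.
  rewrite (_ : (fun u => _) = fun u => \sum_(i < n) a i * f0 (x + b i + u)).
    apply: (cvg_big (op := +%R)); first exact: add_continuous.
    by move=> i _; apply: cvgM; [exact: cvg_cst|exact: cf0].
  by apply/funext => u; rewrite DE; apply: eq_bigr => i _; rewrite addrAC.
pose d := `|D f x - g x|.
have d0 : 0 < d by rewrite normr_gt0 subr_eq0; apply/eqP.
pose A := \sum_(i < n) `|a i|.
have A0 : 0 <= A by apply: sumr_ge0.
have A10 : 0 < 4 * (A + 1) by lra.
(* Two errors of size [e] in the values of [f] change [D f] by less than
   [d / 2]. *)
have [e] := @rat_in_itvoo R 0 (d / (4 * (A + 1))) ltac:(by rewrite divr_gt0).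
rewrite in_itv/= => /andP[e0 ed].
have e20 : 0 < ratr e / 2 :> R by rewrite divr_gt0.
pose Gf i := [set u | `|f (x + b i) - f (x + b i + u)| < ratr e / 2].
pose Gg := [set u | `|g x - g (x + u)| < d / 2].
have FGf i : density_filter sm (Gf i).
  by have /cvgrPdist_lt := cf i; exact.
have FGg : density_filter sm Gg.
  by have /cvgrPdist_lt := cg; apply; rewrite divr_gt0.
(* [n.+1] sets are discarded in the end, [n] for [f] and one for [g].  At the
   scale [2 * r] each has size at most [eps * (2 * r) = w / 2], which leaves
   room for a rational [t] up to [w = r / n.+1]. *)
pose eps : R := (4 * n.+1%:R)^-1.
have eps0 : 0 < eps by rewrite invr_gt0 mulr_gt0.
have [r2 [r20 sf sg]] : exists r, [/\ 0 < r,
    forall i, small sm (eps * r) (ball 0 r `\` Gf i) &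
    small sm (eps * r) (ball 0 r `\` Gg)].
  have [//|r] := @filter_ex _ (0:R)^'+ _ (fun r => [/\ 0 < r,
    forall i, small sm (eps * r) (ball 0 r `\` Gf i) &
    small sm (eps * r) (ball 0 r `\` Gg)]); last by exists r.
  near=> r; split; first by [].
    by near: r; apply: filter_forall => i; exact: FGf.
  by near: r; exact: FGg.
pose r := r2 / 2; have r0 : 0 < r by rewrite divr_gt0.
have r2E : r2 = 2 * r by rewrite /r mulrCA divff ?mulr1.
have /choice[p pP] i : exists p : rat, `|ratr p - (x + b i)| < r / 4.
  have [p] := @rat_in_itvoo R (x + b i - r / 4) (x + b i + r / 4) ltac:(lra).
  rewrite in_itv/= => /andP[? ?]; exists p.
  by rewrite ltr_norml; apply/andP; split; lra.
have /choice[q qP] i : exists q : rat, `|ratr q - f (x + b i)| < ratr e / 2.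
  have [q] := @rat_in_itvoo R (f (x + b i) - ratr e / 2)
    (f (x + b i) + ratr e / 2) ltac:(lra).
  rewrite in_itv/= => /andP[? ?]; exists q.
  by rewrite ltr_norml; apply/andP; split; lra.
(* A rational radius [s] such that the ball of centre [p i] contains the ball
   of radius [r] and lies in the one of radius [2 * r] around [x + b i]. *)
have [s] := @rat_in_itvoo R (5 / 4 * r) (7 / 4 * r) ltac:(lra).
rewrite in_itv/= => /andP[s1 s2].
have [w wE] : exists w, w = r / n.+1%:R by eexists.
have er2 : eps * r2 = w / 2.
  by rewrite r2E /eps wE; field; rewrite addrC natr1 pnatr_eq0.
have w0 : 0 < w by rewrite wE divr_gt0.
have [t] := @rat_in_itvoo R (w / 2) w ltac:(lra).
rewrite in_itv/= => /andP[t1 t2].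
exists [seq (p i, s, t, q i, e) | i <- enum 'I_n]; split.
  move=> _ _ _ _ _ /mapP[i _ [-> -> -> -> ->]].
  have /(small_shift (- (x + b i))) := sf i.
  apply: smallS; last by rewrite er2 ltW.
  move=> y [py nfy] /=; rewrite /ball /=.
  move: (pP i) py; rewrite /rball /ball /= !ltr_norml.
  move=> /andP[p1 p2] /andP[y1 y2]; split.
    by apply/andP; split; lra.
  rewrite /Gf /= addNKr => fy; apply: nfy => /=.
  rewrite /rball /ball/=; move: (qP i) fy; rewrite !ltr_norml.
  by move=> /andP[? ?] /andP[? ?]; apply/andP; split; lra.
move=> f' sf' Df'.
pose Z i := [set u | (rball (p i) s `\` f' @^-1` rball (q i) e) (x + b i + u)].
have sZ i : small sm w (Z i).
  apply: (@smallS _ _ sm (Z i) _ (ratr t)) => //; first exact: ltW.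
  by apply: small_shift; apply: sf'; apply/mapP; exists i; rewrite ?mem_enum.
have sZg : small sm w (ball 0 r2 `\` Gg).
  by apply: smallS sg => //; rewrite er2; lra.
have := smallU (small_bigU sZ) sZg.
rewrite sumr_const card_ord -mulrSr -[_ *+ _]mulr_natr wE divfK ?pnatr_eq0//.
have nsr := @small_ball _ _ sm _ r0.
move=> sr; apply: nsr; apply: smallS sr => // u ru.
have ur : `|u| < r by move: ru; rewrite /ball /= sub0r normrN.
have [Ggu|nGgu] := pselect (Gg u); last first.
  by right; split=> //; rewrite /ball /= sub0r normrN r2E; lra.
left; apply: contrapT => nZ.
have f'near i : `|f' (x + b i + u) - f (x + b i)| < 2 * ratr e.
  have : rball (q i) e (f' (x + b i + u)).
    apply: contrapT => nq; apply: nZ; rewrite (bigD1 i)//=; left.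
    split=> //; rewrite /rball /ball /=.
    move: (pP i) ur; rewrite !ltr_norml => /andP[? ?] /andP[? ?].
    by apply/andP; split; lra.
  rewrite /rball /ball /=; move: (qP i); rewrite !ltr_norml.
  by move=> /andP[? ?] /andP[? ?]; apply/andP; split; lra.
have : `|D f' (x + u) - D f x| < d / 2.
  rewrite !DE -sumrB; apply: (@le_lt_trans _ _ (2 * ratr e * A)).
    rewrite /A mulr_sumr; apply: le_trans (ler_norm_sum _ _ _) _.
    apply: ler_sum => i _; rewrite -mulrBr normrM mulrC ler_wpM2r//.
    by rewrite addrAC ltW.
  move: ed; rewrite ltr_pdivlMr// => ed; nra.
rewrite Df'; move: Ggu; rewrite /Gg /= => Ggu f'u.
have : d < d; last by rewrite ltxx.
rewrite {1}/d.
rewrite (_ : _ - _ = (D f x - g (x + u)) + (g (x + u) - g x)); last by ring.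
apply: le_lt_trans (ler_normD _ _) _; rewrite distrC [X in _ + X]distrC; lra.
Unshelve. all: by end_near. Qed.


(** For each code choose one equation of [S] that no function satisfying the
code solves, if there is one.  A solution of the chosen equations that failed
some equation of [S] modulo [I] would satisfy a code separating it from that
equation, and so it would fail the equation chosen for the code. *)
Lemma countable_subsystem S : is_system S ->
  (forall E, S E -> exists2 f, BI_measurable I f & E.1 f = E.2) ->
  exists S0, [/\ S0 `<=` S, countable S0 &
    forall f, BI_measurable I f -> is_solution S0 f ->
      forall D g, S (D, g) -> I [set x | D f x <> g x]].
Proof.
move=> sysS solS.
pose P k (E : ((R -> R) -> (R -> R)) * (R -> R)) :=
  S E /\ forall f, satisfies k f -> E.1 f <> E.2.
have /choice[E EP] k : exists E, (exists E', P k E') -> P k E.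
  have [[E PE]|no] := pselect (exists E, P k E); first by exists E.
  by exists (id, cst 0) => /no.
exists (E @` [set k | P k (E k)]); split.
- by move=> _ [k [SE _] <-].
- apply: sub_countable (card_image_le _ _) _; exact: countableP.
- move=> f mf solf D g SDg; apply: contrapT => nI.
  have [DD _] := sysS _ SDg; have [f0 mf0 Df0] := solS _ SDg.
  have [k [kf kE]] := separating_code DD mf0 Df0 mf nI.
  have [SE nE] : P k (E k) by apply: EP; exists (D, g).
  apply: (nE f kf); apply: solf; exists k; last by rewrite -surjective_pairing.
  by split.
Qed.

End countable_subsystem.

(** * Solving the system *)

Section solvability.
Set Implicit Arguments.
Unset Strict Implicit.
Local Open Scope ring_scope.
Context {R : realType} {I : set (set R)} (sm : smallness I).

(** A countable cofinal family would cover the line by a set of [I]. *)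
Lemma cofinal_family_infinite A : cofinal_family I A -> infinite_set A.
Proof.
move=> [AI Acof] /finite_set_countable cA; apply: (idealN sm).
have : I (\bigcup_(X in A) X) by apply: (ideal_bigcup_countable sm).
apply: (ideal_sub sm) => x _.
by have [Y [AY xY]] := Acof _ (ideal_set1 sm x); exists Y => //; exact: xY.
Qed.

(** The subsystems of at most [cof I] equations used here are the single
equations, a countable subsystem that forces the others modulo [I], and the
union of the finite obstructions attached to a cofinal family. *)
Lemma sc_property_succ_cof : sc_property (BI_measurable I) (succ_card (cof I)).
Proof.
move=> S sysS solS.
have [[A [[AI Acof] cofA]] _] := cofP I.
have infA : [set: nat] #<= [set: A].
  rewrite (card_le_eqr (card_setT A)); apply/infiniteP.
  exact: cofinal_family_infinite.
have Acof_le : [set: A] #<= [set: cof I].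
  by rewrite (card_le_eql (card_setT A)) -(card_le_eql cofA).
have small_sub T : T `<=` S -> T #<= [set: A] ->
    solvable_in (BI_measurable I) T.
  move=> TS TA; apply: solS => //; apply: card_le_lt_succ.
  exact: card_le_trans TA Acof_le.
have sol1 E : S E -> exists2 f, BI_measurable I f & E.1 f = E.2.
  move=> SE; have [||f mf solf] := small_sub [set E].
  - by move=> _ ->.
  - by apply: card_le_trans infA; exact: countable1.
  - by exists f => //; apply: solf; rewrite -surjective_pairing.
have [S0 [S0S cS0 S0P]] := countable_subsystem sm sysS sol1.
have [f0 mf0 solf0] := small_sub _ S0S (card_le_trans cS0 infA).
have [T [TD Tae TI]] := lifting sm.
(* [h] is supported in [B] and corrects the defect of [T] on the equations
   of [F]. *)
pose twisted (F : set (((R -> R) -> (R -> R)) * (R -> R))) (B : set R) h :=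
  (forall x, ~ B x -> h x = 0) /\
  forall E, F E -> E.1 h = (fun x => E.2 x - T E.2 x).
have twistedP f F : F `<=` S -> is_solution F f ->
    forall B, [set x | T f x <> f x] `<=` B ->
    twisted F B (fun x => f x - T f x).
  move=> FS solf B TfB; split=> [x nBx|[D g] FDg].
    apply: contrapT => ne; apply: nBx; apply: TfB => /= e; apply: ne.
    by rewrite e subrr.
  have [DD _] := sysS _ (FS _ FDg); rewrite /= -(solf _ _ FDg) -TD//.
  have [n [a [b /= DE]]] := DD; apply/funext => x; rewrite !DE -sumrB.
  by apply: eq_bigr => i _; rewrite mulrBr.
(* Otherwise a finite obstruction [F B] for each [B] of the cofinal family
   assembles into a subsystem with at most [cof I] equations. *)
have [B AB finB] : exists2 B, A B & forall F, finite_set F -> F `<=` S ->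
    exists h, twisted F B h.
  apply: contrapT => noB.
  have /choice[F FP] : forall B : A, exists F, [/\ finite_set F, F `<=` S &
      ~ exists h, twisted F (val B) h].
    move=> B; apply: contrapT => noF; apply: noB; exists (val B).
      exact: set_valP.
    move=> F finF FS; apply: contrapT => noh; apply: noF.
    by exists F.
  have [||f mf solf] := small_sub (\bigcup_B F B).
  - by move=> E [B _]; have [_ + _] := FP B; exact.
  - apply: card_bigcup_countable => // B; apply: finite_set_countable.
    by have [] := FP B.
  - have [B [AB TfB]] := Acof _ (TI _ mf).
    have [_ FS] := FP (SigSub (mem_set AB)); apply.
    exists (fun x => f x - T f x); apply: twistedP => //.
    by move=> D g FDg; apply: solf; exists (SigSub (mem_set AB)).
have [||h [hB hS]] := @linear_compactness R R
    ((((R -> R) -> (R -> R)) * (R -> R)) * R)%type [set w | S w.1]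
    (fun w h => w.1.1 h w.2) (fun w => w.1.2 w.2 - T w.1.2 w.2) B.
- move=> [[D g] x] /= /sysS[[n [a [b /= DE]]] _].
  by exists n, a, (fun i => x + b i) => f; rewrite DE.
- move=> F finF FS; have [||h [hB hF]] := finB (fst @` F).
  + exact: finite_image.
  + by move=> _ [w Fw <-]; exact: FS.
  + exists h; split=> // -[E x] FEx /=.
    by rewrite hF//; exists (E, x).
exists (fun x => T f0 x + h x).
  apply: (BI_measurable_ae sm mf0).
  have := idealU sm (TI _ mf0) (AI _ AB).
  apply: (ideal_sub sm) => x /= ne.
  apply: contrapT => /not_orP[/contrapT e nBx].
  by apply: ne; rewrite hB// addr0.
move=> D g SDg; have [DD _] := sysS _ SDg; apply/funext => x.
have [n [a [b /= DE]]] := DD.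
transitivity (D (T f0) x + D h x).
  by rewrite !DE -big_split/=; apply: eq_bigr => i _; rewrite mulrDr.
have -> : D (T f0) = T g by rewrite TD//; apply: Tae; exact: S0P.
by have /= -> := hS ((D, g), x) SDg; rewrite addrC subrK.
Qed.

End solvability.

(** * Generated sigma-algebras modulo an ideal *)

Section mod_ideal.
Set Implicit Arguments.
Unset Strict Implicit.
Local Open Scope ring_scope.
Context {R : realType}.

(** Used with [U] the Borel sets and the null sets, and with [U] the open sets
and the meager sets. *)
Lemma sigma_algebra_mod_ideal (I U G : set (set R)) :
  (forall A B, B `<=` A -> I A -> I B) ->
  (forall F : (set R)^nat, (forall n, I (F n)) -> I (\bigcup_n F n)) ->
  I set0 -> U set0 ->
  (forall V, U V -> exists2 W, U W & I [set x | ~ (~ V x <-> W x)]) ->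
  (forall F : (set R)^nat, (forall n, U (F n)) -> U (\bigcup_n F n)) ->
  (forall B, G B -> exists2 V, U V & I [set x | ~ (B x <-> V x)]) ->
  forall B, <<s G >> B -> exists2 V, U V & I [set x | ~ (B x <-> V x)].
Proof.
move=> Isub Icup I0 U0 UC Ucup GU.
apply: smallest_sub => //; split=> [|B [V UV IV]|F].
- by exists set0 => //; apply: Isub I0 => x; apply: contra_notP => _.
- have [W UW IW] := UC _ UV; exists W => //.
  pose F n := if n is 0%N then [set x | ~ (B x <-> V x)]
              else [set x | ~ (~ V x <-> W x)].
  have /Icup : forall n, I (F n) by case.
  apply: Isub => x /= ne.
  have [bv|] := pselect (B x <-> V x); last by exists 0%N.
  by exists 1%N => //= vw; apply: ne; tauto.
- move=> /(_ _)/cid2 FU; pose V n := s2val (FU n).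
  exists (\bigcup_n V n); first by apply: Ucup => n; exact: (s2valP (FU n)).
  have := Icup _ (fun n => s2valP' (FU n)).
  apply: Isub => x /= ne; apply: contrapT => nx; apply: ne.
  split=> -[n _ Fx]; exists n => //; apply: contrapT => nV; apply: nx.
    by exists n => //= -[+ _] => /(_ Fx).
  by exists n => //= -[_ +] => /(_ Fx).
Qed.

End mod_ideal.

(** * The ideal of null sets *)

Section null_ideal.
Set Implicit Arguments.
Unset Strict Implicit.
Local Open Scope ring_scope.
Context {R : realType}.
Local Notation mu := (@lebesgue_measure R).

Lemma measurable_fun_shift (c : R) :
  measurable_fun [set: measurableTypeR R]
    ((fun x => c + x) : measurableTypeR R -> measurableTypeR R).
Proof.
by apply: measurable_funD; [exact: measurable_cst|exact: measurable_id].
Qed.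

Lemma measurable_shift (A : set R) c : measurable A ->
  measurable [set x | A (c + x)].
Proof.
move=> mA; have := measurable_fun_shift c measurableT mA.
by rewrite setTI.
Qed.

Lemma lebesgue_measure_shift (A : set R) c : measurable A ->
  mu [set x | A (c + x)] = mu A.
Proof.
move=> mA.
have mc := measurable_fun_shift c.
pose nu := pushforward mu
  ((fun x => c + x) : measurableTypeR R -> measurableTypeR R).
rewrite -[LHS]/(nu A); apply/esym.
apply: (@lebesgue_measure_unique R nu) => //= _ [[a b]] _ <-.
rewrite /nu /pushforward (_ : _ @^-1` _ = `]a - c, b - c]%classic).
  rewrite !lebesgue_measure_itv/= !lte_fin ltrD2r.
  by case: ifP => // _; rewrite -!EFinB; congr EFin; ring.
apply/seteqP; split=> x /=; rewrite !in_itv/= => /andP[? ?].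
  by apply/andP; split; lra.
by apply/andP; split; lra.
Qed.

(** The outer measure of [A] is at most [e]. *)
Definition outer_le (e : R) (A : set R) :=
  exists Z, [/\ measurable Z, A `<=` Z & (mu Z <= e%:E)%E].

Lemma lebesgue_density_outer (B : set R) : measurable B ->
  null_ideal [set y | B y /\ ~ forall e, 0 < e ->
    \forall r \near 0^'+, outer_le (e * r) (ball y r `\` B)].
Proof.
move=> mB; have := lebesgue_density mB.
rewrite /null_ideal /=; apply: negligibleS => y [By nd].
move=> cd; apply: nd => e e0; move: cd => /=; rewrite indicE mem_set//.
move=> /fine_cvgP[_]; move=> /cvgrPdist_lt /(_ (e / 2)) /=.
rewrite divr_gt0// => /(_ isT) cd.
near=> r; exists (ball y r `\` B); split=> //.
  by apply: measurableD => //; exact: measurable_ball.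
have r0 : 0 < r by [].
have : `|1 - fine (mu (B `&` ball y r) * (mu (ball y r))^-1)| < e / 2.
  by near: r.
have mball : mu (ball y r) = (r *+ 2)%:E by rewrite lebesgue_measure_ball// ltW.
have mBb : measurable (B `&` ball y r).
  by apply: measurableI => //; exact: measurable_ball.
have : (mu (B `&` ball y r) <= (r *+ 2)%:E)%E.
  by rewrite -mball; apply: le_measure; rewrite ?inE//; exact: measurable_ball.
have : (0 <= mu (B `&` ball y r))%E by exact: measure_ge0.
rewrite measureD//=; last 2 first.
  exact: measurable_ball.
  by rewrite mball ltry.
rewrite mball [B `&` _]setIC.
case: (mu (ball y r `&` B)) => [a| |]//; rewrite !lee_fin => a0 ar.
rewrite inver mulrn_eq0/= gt_eqF// -EFinM/= ltr_norml => /andP[_].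
rewrite ltrBlDr -ltrBlDl => ae.
have : (1 - e / 2) * (r *+ 2) < a by rewrite -ltr_pdivlMr ?mulrn_wgt0.
have -> : (1 - e / 2) * (r *+ 2) = r *+ 2 - e * r by field.
by rewrite ltrBlDr -ltrBlDl => /ltW.
Unshelve. all: by end_near. Qed.

Lemma null_smallness : smallness (@null_ideal R).
Proof.
have nS (A B : set R) : B `<=` A -> null_ideal A -> null_ideal B.
  exact: (@negligibleS _ _ _ mu).
have n0 : null_ideal (@set0 R) by exact: (@negligible_set0 _ _ _ mu).
have nU (F : (set R)^nat) : (forall n, null_ideal (F n)) ->
    null_ideal (\bigcup_n F n).
  exact: (@negligible_bigcup _ _ _ mu).
apply: (@Smallness R _ outer_le).
- exact: nS.
- exact: nU.
- move=> A c [Z [mZ Z0 AZ]]; exists [set x | Z (c + x)]; split.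
  + exact: measurable_shift.
  + by rewrite lebesgue_measure_shift.
  + by move=> x /AZ.
- move=> x; exists [set x]; split=> //; exact: lebesgue_measure_set1.
- by exists set0; split=> //; rewrite measure0.
- move=> A B e e' BA ee' [Z [mZ AZ Ze]]; exists Z; split=> //.
    exact: subset_trans AZ.
  by apply: le_trans Ze _; rewrite lee_fin.
- move=> A B e e' [Z [mZ AZ Ze]] [Y [mY BY Ye]]; exists (Z `|` Y); split.
  + exact: measurableU.
  + exact: setUSS.
  + by apply: le_trans (measureU2 _ _ _) _ => //; rewrite EFinD leeD.
- move=> A c e [Z [mZ AZ Ze]]; exists [set x | Z (c + x)]; split.
  + exact: measurable_shift.
  + by move=> x /AZ.
  + by rewrite lebesgue_measure_shift.
- move=> A e [Z [mZ Z0 AZ]] e0; exists Z; split=> //.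
  by rewrite Z0 lee_fin ltW.
- move=> r r0 [Z [mZ bZ]]; apply/negP; rewrite -ltNge.
  apply: (@lt_le_trans _ _ (mu (ball 0 r))).
    by rewrite lebesgue_measure_ball ?ltW// lte_fin mulr2n ltrDl.
  by apply: le_measure => //; rewrite inE//; exact: measurable_ball.
- move=> B sB.
  have [V mV IV] : exists2 V, measurable V &
      null_ideal [set x | ~ (B x <-> V x)].
    apply: (@sigma_algebra_mod_ideal R (@null_ideal R) measurable
      _ _ _ _ _ _ _ _ _ sB) => //.
    + move=> V mV; exists (~` V); first exact: measurableC.
      by apply: nS n0 => x; apply; split.
    + by move=> F mF; exact: bigcup_measurable.
    + move=> {sB}B [mB|IB].
        by exists B => //; apply: nS n0 => x; apply; split.
      exists set0 => //; apply: nS IB => x /= ne.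
      by apply: contrapT => nB; apply: ne; split.
  have := negligibleU (mu := mu) (lebesgue_density_outer mV) IV.
  apply: nS => y [By nd].
  have [Vy|nVy] := pselect (V y); last by right=> -[/(_ By)].
  left; split=> //; apply: contra_not nd => dV e e0.
  have e20 : 0 < e / 2 by rewrite divr_gt0.
  near=> r; have [Z [mZ VZ Ze]] : outer_le (e * r) (ball y r `\` V).
    by near: r; exact: dV.
  have [Y [mY Y0 VY]] := IV.
  exists [set u | (Z `|` Y) (y + u)]; split.
  + by apply: measurable_shift; exact: measurableU.
  + move=> u [ru nB] /=; have [Vu|nVu] := pselect (V (y + u)).
      by right; apply: VY => /= -[_ /(_ Vu)].
    left; apply: VZ; split=> //; move: ru; rewrite /ball/= sub0r.
    by rewrite opprD addrA subrr sub0r.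
  + rewrite lebesgue_measure_shift; last exact: measurableU.
    apply: le_trans (measureU2 _ _ _) _ => //.
    have Yle : (mu Y <= 0)%E by rewrite Y0.
    by rewrite -[leRHS]adde0; exact: leeD.
Unshelve. all: by end_near. Qed.

End null_ideal.

(** * The ideal of meager sets *)

Section meager_ideal.
Set Implicit Arguments.
Unset Strict Implicit.
Local Open Scope ring_scope.
Context {R : realType}.

Lemma nowhere_dense_sub (A B : set R) : B `<=` A -> nowhere_dense A ->
  nowhere_dense B.
Proof.
move=> BA A0; apply/seteqP; split=> // x Bx; rewrite -A0.
by move: Bx; apply: interiorS; exact: closureS.
Qed.

Lemma nowhere_dense_shift (A : set R) c : nowhere_dense A ->
  nowhere_dense [set x | A (c + x)].
Proof.
move=> A0; apply/seteqP; split=> // p Ap.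
suff : (closure A)° (c + p) by rewrite A0.
have shiftn a (q : R) W : nbhs (a + q) W -> nbhs q [set x | W (a + x)].
  have cW : a + x @[x --> q] --> a + q.
    by apply: cvgD; [exact: cvg_cst|exact: cvg_id].
  by move=> nW; exact: cW _ nW.
have : nbhs (- c + (c + p)) (closure [set x | A (c + x)]) by rewrite addKr.
move=> /shiftn; apply: filterS => y /= cy W nW.
have : nbhs (- c + y) [set x | W (c + x)] by apply: shiftn; rewrite addNKr.
by move=> /cy[x [Ax Wx]]; exists (c + x).
Qed.

Lemma nowhere_dense_set1 (x : R) : nowhere_dense [set x].
Proof.
apply/seteqP; split=> // y; rewrite /interior => /nbhs_ballP[e /= e0 be].
have cx z : closure [set x] z -> z = x.
  have clx : closed [set x].
    apply: accessible_closed_set1; apply: hausdorff_accessible.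
    exact: Rhausdorff.
  by rewrite -((closure_id _).1 clx).
have : y + e / 2 = y.
  rewrite [LHS]cx ?[RHS]cx//; apply: be; first exact: ballxx.
  by rewrite /ball /= opprD addrA subrr sub0r normrN gtr0_norm; lra.
move=> /eqP; rewrite -subr_eq0; lra.
Qed.

Lemma meager_sub (A B : set R) : B `<=` A -> meager_ideal A -> meager_ideal B.
Proof.
move=> BA [F [F0 AF]]; exists (fun n => F n `&` B); split.
  by move=> n; apply: nowhere_dense_sub (F0 n) => x [].
by rewrite -setI_bigcupl -AF; apply/esym/setIidr.
Qed.

Lemma nowhere_dense_set0 : nowhere_dense (@set0 R).
Proof. exact: nowhere_dense_sub (nowhere_dense_set1 0). Qed.

Lemma nowhere_dense_meager (A : set R) : nowhere_dense A -> meager_ideal A.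
Proof.
move=> A0; exists (fun=> A); split=> //.
by rewrite bigcup_const//; exists 0%N.
Qed.

Lemma meager_bigcup (F : (set R)^nat) : (forall n, meager_ideal (F n)) ->
  meager_ideal (\bigcup_n F n).
Proof.
move=> /choice[G GP].
exists (fun n => if unpickle n is Some p then G p.1 p.2 else set0); split.
  move=> n; case: unpickle => [p|]; last exact: nowhere_dense_set0.
  by have [+ _] := GP p.1; exact.
apply/seteqP; split=> [x [n _]|x [k _]].
  have [_ ->] := GP n => -[m _ Gx].
  by exists (pickle (n, m)) => //; rewrite pickleK.
case: unpickle => // p Gx; exists p.1 => //; have [_ ->] := GP p.1.
by exists p.2.
Qed.

(** Baire's theorem, applied to the complements of the closures. *)
Lemma ball_not_meager (x r : R) : 0 < r -> ~ meager_ideal (ball x r).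
Proof.
move=> r0 [F [F0 bF]].
have oF n : open (~` closure (F n)) /\ dense (~` closure (F n) : set R^o).
  split; first by apply: closed_openC; exact: closed_closure.
  move=> O [z Oz] oO; apply: contrapT => nO.
  suff : (closure (F n))° z by rewrite F0.
  move: Oz; rewrite -((interior_id O).1 oO); apply: interiorS => w Ow.
  by apply: contrapT => nw; apply: nO; exists w.
have [||y [by_ nFy]] := @Baire R R^o _ oF (ball x r).
- by exists x; exact: ballxx.
- exact: ball_open.
- move: (by_); rewrite bF => -[n _ Fy].
  by apply: (nFy n) => //; exact: subset_closure.
Qed.

Lemma closed_minus_interior (C : set R) : closed C -> nowhere_dense (C `\` C°).
Proof.
move=> cC; apply/seteqP; split=> // x.
have cD : closed (C `\` C°).
  by apply: closedI => //; apply: open_closedC; exact: open_interior.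
rewrite -(closure_id _).1// => xD.
have [_] := interior_subset xD; apply.
by move: xD; apply: interiorS => y [].
Qed.

(** A set with the Baire property is open up to a meager set, so that near each
of its points, outside a meager set of exceptions, only a meager set is
missing.  The complement of an open set is handled by dropping its nowhere
dense boundary. *)
Lemma meager_smallness : smallness (@meager_ideal R).
Proof.
have M0 := nowhere_dense_meager nowhere_dense_set0.
have shiftM (A : set R) c : meager_ideal A -> meager_ideal [set x | A (c + x)].
  move=> [F [F0 ->]]; exists (fun n => [set x | F n (c + x)]); split=> //.
  by move=> n; exact: nowhere_dense_shift.
apply: (@Smallness R _ (fun _ => meager_ideal)).
- exact: meager_sub.
- exact: meager_bigcup.
- exact: shiftM.
- by move=> x; apply: nowhere_dense_meager; exact: nowhere_dense_set1.
- by [].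
- by move=> A B e e' BA _; exact: meager_sub.
- move=> A B e e' mA mB; rewrite -bigcup2E; apply: meager_bigcup.
  by case=> [|[|n]].
- by move=> A c _; exact: shiftM.
- by [].
- by move=> r r0; exact: ball_not_meager.
- have sdiff0 (V : set R) : meager_ideal [set x | ~ (V x <-> V x)].
    by apply: meager_sub M0 => x; apply; split.
  have UC (V : set R) : open V -> exists2 W, open W &
      meager_ideal [set x | ~ (~ V x <-> W x)].
    move=> oV; exists (~` V)°; first exact: open_interior.
    have CI := closed_minus_interior (open_closedC oV).
    apply: meager_sub (nowhere_dense_meager CI).
    move=> x /= ne; have [Wx|nWx] := pselect ((~` V)° x).
      by case: ne; split=> // _; exact: interior_subset Wx.
    by split=> //; move=> Vx; apply: ne; split=> //; case.
  (* The Borel sets are treated first, as the generators of the larger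
     sigma-algebra include all of them. *)
  have borel (B : set R) : measurable B ->
      exists2 V, open V & meager_ideal [set x | ~ (B x <-> V x)].
    move=> mB.
    have sB : <<s @RGenOpens.G R >> B.
      by rewrite -[<<s _ >>]RGenOpens.measurableE.
    apply: (@sigma_algebra_mod_ideal R (@meager_ideal R) open
      _ _ _ _ _ _ _ _ _ sB) => //.
    + exact: meager_sub.
    + exact: meager_bigcup.
    + by move=> F oF; exact: bigcup_open.
    + by move=> _ [x [y ->]]; exists `]x, y[%classic.
  move=> B sB.
  have [V oV IV] : exists2 V, open V & meager_ideal [set x | ~ (B x <-> V x)].
    apply: (@sigma_algebra_mod_ideal R (@meager_ideal R) open
      _ _ _ _ _ _ _ _ _ sB) => //.
    + exact: meager_sub.
    + exact: meager_bigcup.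
    + by move=> F oF; exact: bigcup_open.
    + move=> {sB}B [/borel//|IB].
      exists set0; first exact: open0.
      apply: meager_sub IB => x /= ne.
      by apply: contrapT => nB; apply: ne; split.
  apply: (meager_sub _ IV) => y [By nd] [/(_ By) Vy _]; apply: nd => e e0.
  have : nbhs y V by apply: open_nbhs_nbhs; split.
  move=> /nbhs_ballP[d /= d0 dV]; near=> r.
  apply: meager_sub (shiftM _ y IV) => u [ru nBu] /=; apply: contra_not nBu.
  move=> [_]; apply; apply: dV; move: ru; rewrite /ball/= sub0r normrN => ur.
  rewrite opprD addrA subrr sub0r normrN; apply: lt_trans ur _.
  by near: r; exact: nbhs_right_lt.
Unshelve. all: by end_near. Qed.

End meager_ideal.

Theorem theorem8p6 (R : realType) (I : set (set R))
    (hI : I = null_ideal \/ I = meager_ideal) :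
  [set: sc (BI_measurable I)] #<= [set: succ_card (cof I)].
Proof.
have [_ scmin] := scP (BI_measurable I); apply: scmin.
have sm : smallness I -> sc_property (BI_measurable I) (succ_card (cof I)).
  by move=> s; exact: sc_property_succ_cof.
case: hI sm => -> sm; apply: sm; first exact: null_smallness.
exact: meager_smallness.
Qed.
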